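(* For all integers $J\ge 0$ and $N\ge 0$, $$MO(1,5J+4;5N+2)\equiv 0\pmod 5,\qquad MO(1,7J+6;7N+1)\equiv 0\pmod 7,\qquad MO(1,11J+10;11N+7)\equiv 0\pmod{11}.$$
   Context: For an integer $a$ and a nonnegative integer $t$, define $MO(a,t;n)$ by the formal power series identity $$\sum_{n\ge 0}MO(a,t;n)\,q^n=\sum_{1\le n_1<n_2<\cdots<n_t}\frac{q^{n_1+n_2+\cdots+n_t}}{\prod_{k=1}^t(1+aq^{n_k}+q^{2n_k})},$$ where each factor $1/(1+aq^{m}+q^{2m})$ is expanded as a power series in $q$ with integer coefficients. *)

(* Defs.v *)
From HB Require Import structures.
From mathcomp Require Import all_boot all_order all_algebra.
From mathcomp Require Import boolp classical_sets functions cardinality fsbigop.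

Set Implicit Arguments.
Unset Strict Implicit.
Unset Printing Implicit Defensive.

Import GRing.Theory.
Local Open Scope classical_set_scope.
Local Open Scope ring_scope.

(* Univariate formal power series; [f n] is the coefficient of q^n in f. *)
Record fps (R : Type) := Fps { fps_coef :> nat -> R }.

Lemma fpsP (R : Type) (f g : fps R) : (forall n, f n = g n) -> f = g.
Proof. by case: f g => [f] [g] /= fg; congr Fps; apply/funext. Qed.

HB.instance Definition _ (R : Type) := gen_eqMixin (fps R).
HB.instance Definition _ (R : Type) := gen_choiceMixin (fps R).

Section FpsRing.
Variable R : comNzRingType.
Implicit Types f g h : fps R.

Definition fps_zero : fps R := Fps (fun=> 0).
Definition fps_opp f : fps R := Fps (fun n => - f n).
Definition fps_add f g : fps R := Fps (fun n => f n + g n).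
Definition fps_one : fps R := Fps (fun n => (n == 0)%N%:R).
Definition fps_mul f g : fps R :=
  Fps (fun n => \sum_(i < n.+1) f i * g (n - i)%N).

Fact fps_addA : associative fps_add.
Proof. by move=> f g h; apply: fpsP => n /=; rewrite addrA. Qed.
Fact fps_addC : commutative fps_add.
Proof. by move=> f g; apply: fpsP => n /=; rewrite addrC. Qed.
Fact fps_add0 : left_id fps_zero fps_add.
Proof. by move=> f; apply: fpsP => n /=; rewrite add0r. Qed.
Fact fps_addN : left_inverse fps_zero fps_opp fps_add.
Proof. by move=> f; apply: fpsP => n /=; rewrite addNr. Qed.

HB.instance Definition _ := GRing.isZmodule.Build (fps R)
  fps_addA fps_addC fps_add0 fps_addN.

Definition fps_trunc N f : {poly R} := \poly_(i < N) f i.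

Lemma coef_fps_trunc N f i : (i < N)%N -> (fps_trunc N f)`_i = f i.
Proof. by move=> iN; rewrite coef_poly iN. Qed.

Lemma fps_mul_trunc N f g n : (n < N)%N ->
  fps_mul f g n = (fps_trunc N f * fps_trunc N g)`_n.
Proof.
move=> nN; rewrite coefM; apply: eq_bigr => i _.
by rewrite !coef_fps_trunc ?(leq_ltn_trans (leq_subr _ _)) //
  (leq_ltn_trans _ nN) // -ltnS.
Qed.

Fact fps_mulC : commutative fps_mul.
Proof. by move=> f g; apply: fpsP => n; rewrite !(@fps_mul_trunc n.+1) // mulrC. Qed.

Fact fps_mulA : associative fps_mul.
Proof.
move=> f g h; apply: fpsP => n; rewrite !(@fps_mul_trunc n.+1) //.
transitivity ((fps_trunc n.+1 f * fps_trunc n.+1 g * fps_trunc n.+1 h)`_n).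
  rewrite -mulrA !coefM; apply: eq_bigr => i _; congr (_ * _).
  have lt : (n - i < n.+1)%N by rewrite ltnS leq_subr.
  by rewrite coef_fps_trunc // (@fps_mul_trunc n.+1).
rewrite !coefM; apply: eq_bigr => i _; congr (_ * _).
by rewrite coef_fps_trunc // (@fps_mul_trunc n.+1).
Qed.

Fact fps_mul1 : left_id fps_one fps_mul.
Proof.
move=> f; apply: fpsP => n /=; rewrite big_ord_recl /= mul1r subn0.
by rewrite big1 ?addr0 // => i _; rewrite mul0r.
Qed.

Fact fps_mulDl : left_distributive fps_mul fps_add.
Proof.
move=> f g h; apply: fpsP => n /=; rewrite -big_split /=.
by apply: eq_bigr => i _; rewrite mulrDl.
Qed.

Fact fps_one_neq0 : fps_one != 0.
Proof.
apply/eqP => /(congr1 (fun f : fps R => f 0%N)) /= /eqP.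
by rewrite (negPf (oner_neq0 R)).
Qed.

HB.instance Definition _ := GRing.Zmodule_isComNzRing.Build (fps R)
  fps_mulA fps_mulC fps_mul1 fps_mulDl fps_one_neq0.

Definition fpsX : fps R := Fps (fun n => (n == 1)%N%:R).
Definition fpsC (c : R) : fps R := Fps (fun n => c *+ (n == 0)%N).

Lemma coef_fps0 n : (0 : fps R) n = 0. Proof. by []. Qed.
Lemma coef_fpsN f n : (- f) n = - f n. Proof. by []. Qed.
Lemma coef_fpsD f g n : (f + g) n = f n + g n. Proof. by []. Qed.
Lemma coef_fps1 n : (1 : fps R) n = (n == 0)%N%:R. Proof. by []. Qed.
Lemma coef_fpsM f g n : (f * g) n = \sum_(i < n.+1) f i * g (n - i)%N.
Proof. by []. Qed.

Lemma coef_fps_sum I (r : seq I) (P : pred I) (F : I -> fps R) n :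
  (\sum_(i <- r | P i) F i) n = \sum_(i <- r | P i) F i n.
Proof. by elim/big_rec2: _ => // i x y _ <-. Qed.

Lemma coef_fpsCM c f n : (fpsC c * f) n = c * f n.
Proof.
rewrite coef_fpsM big_ord_recl /= subn0 big1 ?addr0 // => i _.
by rewrite mulr0n mul0r.
Qed.

Lemma coef_fpsXM f n : (fpsX * f) n = if n is m.+1 then f m else 0.
Proof.
case: n => [|n]; rewrite coef_fpsM big_ord_recl /= mul0r add0r ?big_ord0 //.
rewrite big_ord_recl /= mul1r subSS subn0 big1 ?addr0 // => i _.
by rewrite mul0r.
Qed.

Lemma coef_fpsXnM m f n :
  (fpsX ^+ m * f) n = if (m <= n)%N then f (n - m)%N else 0.
Proof.
elim: m n => [|m IHm] n; first by rewrite expr0 mul1r subn0.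
by rewrite exprS -mulrA coef_fpsXM; case: n => [|n] //; rewrite IHm.
Qed.

Lemma coef_fpsXn m n : (fpsX ^+ m) n = (n == m)%:R.
Proof.
rewrite -[_ ^+ _]mulr1 coef_fpsXnM coef_fps1.
by rewrite subn_eq0 eqn_leq; case: leqP => //= _; rewrite ?andbT ?andbF.
Qed.

Lemma coef_fps_exp_lt h k n : h 0%N = 0 -> (n < k)%N -> (h ^+ k) n = 0.
Proof.
move=> h0; elim: k n => // k IHk n nk; rewrite exprS coef_fpsM.
rewrite big_ord_recl /= h0 mul0r add0r big1 // => i _.
rewrite IHk ?mulr0 //; apply: leq_trans (_ : (n - i <= k)%N).
  by rewrite ltn_sub2l // (leq_trans (ltn_ord i)).
by rewrite leq_subLR (leq_trans _ (leq_addl _ _)).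
Qed.

End FpsRing.

Arguments fpsX {R}.

Section FpsUnit.
Variable R : comUnitRingType.
Implicit Types f g h : fps R.

Definition fps_unit : pred (fps R) := fun f => f 0%N \is a GRing.unit.

(* With c = f 0 and f = c (1 - h), this is c^-1 (1 + h + h^2 + ...); only the
   powers h^k with k <= n contribute to the coefficient of q^n. *)
Definition fps_geom h : fps R := Fps (fun n => \sum_(k < n.+1) (h ^+ k) n).
Definition fps_inv f : fps R :=
  if fps_unit f
  then fpsC (f 0%N)^-1 * fps_geom (1 - fpsC (f 0%N)^-1 * f)
  else f.

Lemma fps_geomP h : h 0%N = 0 -> (1 - h) * fps_geom h = 1.
Proof.
move=> h0; apply: fpsP => n.
transitivity (((1 - h) * \sum_(k < n.+1) h ^+ k) n).
  rewrite !coef_fpsM; apply: eq_bigr => i _; congr (_ * _).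
  have le : ((n - i).+1 <= n.+1)%N by rewrite ltnS leq_subr.
  rewrite coef_fps_sum /=.
  rewrite (big_ord_widen _ (fun k => (h ^+ k) (n - i)%N) le) big_mkcond /=.
  apply: eq_bigr => k _; case: ltnP => // lt.
  by rewrite coef_fps_exp_lt.
by rewrite -opprB mulNr -subrX1 opprB coef_fpsD coef_fpsN
  coef_fps_exp_lt // subr0.
Qed.

Fact fps_mulVr : {in fps_unit, left_inverse 1 fps_inv *%R}.
Proof.
move=> f fU; have {}fU : fps_unit f := fU; rewrite /fps_inv fU.
set c := fpsC _; rewrite mulrAC.
have := @fps_geomP (1 - c * f); rewrite subKr; apply.
by rewrite coef_fpsD coef_fpsN coef_fpsCM mulVr // subrr.
Qed.

Fact fps_unitP f g : g * f = 1 -> fps_unit f.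
Proof.
move=> /(congr1 (fun h : fps R => h 0%N)).
rewrite coef_fpsM big_ord1 /= => gf1.
by apply/unitrP; exists (g 0%N); rewrite [f 0%N * _]mulrC gf1.
Qed.

Fact fps_inv_out : {in [predC fps_unit], fps_inv =1 id}.
Proof. by move=> f fU; have /negPf nfU : ~~ fps_unit f := fU; rewrite /fps_inv nfU. Qed.

HB.instance Definition _ := GRing.ComNzRing_hasMulInverse.Build (fps R)
  fps_mulVr fps_unitP fps_inv_out.

Lemma fps_unitE f : (f \is a GRing.unit) = (f 0%N \is a GRing.unit).
Proof. by []. Qed.

End FpsUnit.

(* A family of power series is summable when each coefficient is nonzero for
   only finitely many members; its sum is then taken coefficientwise. *)
Definition fps_summable (R : comNzRingType) (I : choiceType) (A : set I)
    (F : I -> fps R) : Prop :=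
  forall n, finite_set (A `&` [set i | F i n != 0]).

Definition fps_sum (R : comNzRingType) (I : choiceType) (A : set I)
    (F : I -> fps R) : fps R :=
  Fps (fun n => \sum_(i \in A) F i n).

(* The tuples (n_1, ..., n_t) with 1 <= n_1 < n_2 < ... < n_t. *)
Definition MO_index (t : nat) : set (t.-tuple nat) :=
  [set s : t.-tuple nat | path ltn 0%N s].

Definition MO_den (a : int) (m : nat) : fps int :=
  1 + fpsC a * fpsX ^+ m + fpsX ^+ (2 * m).

Definition MO_term (a : int) (t : nat) (s : t.-tuple nat) : fps int :=
  fpsX ^+ (\sum_(m <- s) m)%N / \prod_(m <- s) MO_den a m.

Definition MO (a : int) (t n : nat) : int :=
  fps_sum (@MO_index t) (@MO_term a t) n.

Lemma MO_den_unit a m : (0 < m)%N -> MO_den a m \is a GRing.unit.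
Proof.
case: m => // m _; rewrite fps_unitE /MO_den !coef_fpsD coef_fpsCM !coef_fpsXn.
by rewrite mulr0 !addr0 unitr1.
Qed.

Lemma MO_prod_den_unit a t (s : t.-tuple nat) : MO_index s ->
  \prod_(m <- s) MO_den a m \is a GRing.unit.
Proof.
rewrite /MO_index /= (path_sortedE ltn_trans) => /andP[/allP s_gt0 _].
by rewrite big_seq rpred_prod // => m /s_gt0 /MO_den_unit.
Qed.

Lemma MO_term_summable a t : fps_summable (@MO_index t) (@MO_term a t).
Proof.
move=> n.
pose g (u : t.-tuple 'I_n.+1) : t.-tuple nat := [tuple of map val u].
apply: (@sub_finite_set _ _ (range g)); last exact/finite_image/finite_finset.
move=> s [_]; change (MO_term a s n != 0 -> range g s).
rewrite /MO_term coef_fpsXnM; case: leqP; last by rewrite eqxx.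
move=> len _.
have s_le m : m \in s -> (m < n.+1)%N.
  move=> ms; rewrite ltnS (leq_trans _ len) //.
  by rewrite (big_rem m) //= leq_addr.
exists [tuple of map inord s] => //; apply: val_inj => /=.
rewrite -map_comp -[RHS]map_id; apply/eq_in_map => m /s_le mn /=.
by rewrite inordK.
Qed.

(* Main.v *)
(* Summing over t, the series of MO(1,t;n) become
     prod_k (1 + (1+z) q^k + q^(2k)) / (1 + q^k + q^(2k)),
   so with E(q) = prod_k (1 - q^k) the Jacobi triple product gives
     E(q^3) * sum_n MO(1,t;n) q^n = sum_n q^(n(n+1)/2) [z^t] V_n(1+z),
   where V_n(w) = sum_k C(n+k,2k) (w-2)^k.  For t = -1 mod p, Lucas' theorem makes
   [z^t] V_n(1+z) vanish mod p unless n = 0 or -1 mod p, and then p divides n(n+1)/2.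
   As E^p is a series in q^p mod p, it remains to see that the coefficients of
   E(q^3)^(kp-1) in one residue class mod p vanish, i.e. Ramanujan's congruences in the
   variable q^3.  For p = 5 and 7 (k = 1) this follows from the expansions of E and E^3
   and -3 (resp. -1) being a nonresidue.  For p = 11 (k = 2) we follow Hirschhorn:
   E^12 = E * E^11 misses five residue classes, which gives five quartic relations between
   the residue parts of E^3, and the wanted part of E^21 = (E^3)^7 is in the ideal they
   generate. *)
From HB Require Import structures.
Require Import Defs.
From mathcomp Require Import all_boot all_order all_algebra.
From mathcomp Require Import classical_sets cardinality fsbigop.
From mathcomp Require Import zify ring.

Set Implicit Arguments.
Unset Strict Implicit.
Unset Printing Implicit Defensive.

Import GRing.Theory.
Local Open Scope ring_scope.

(** * The polynomials V_n *)

(** The case of Lucas' theorem needed here. Vandermonde's identity for [n = p * (n %/ p) + n %% p]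
    gives terms [C(p * (n %/ p), j) * C(n %% p, k - j)]. If [p] divides [j], then
    [k - j >= k %% p > n %% p] and the second factor is 0. Otherwise [p] divides the first factor,
    because [j * C(p m, j) = p m * C(p m - 1, j - 1)]. *)
Lemma prime_dvd_bin_mod (p n k : nat) : prime p -> (n %% p < k %% p)%N ->
  (p %| 'C(n, k))%N.
Proof.
move=> p_pr lt_nk; have p_gt0 := prime_gt0 p_pr.
rewrite (divn_eq n p) -binomial.Vandermonde.
apply: (big_ind (fun m => p %| m)%N) => //; first by move=> x y; apply: dvdn_add.
move=> [j /= ltj] _; have le_jk : (j <= k)%N by [].
have [p_j | p'j] := boolP (p %| j)%N.
  rewrite [X in (_ * X)%N]bin_small ?muln0 //.
  apply: leq_trans lt_nk _; rewrite -{1}(subnK le_jk) -modnDmr.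
  by rewrite (eqP p_j) addn0 leq_mod.
apply: dvdn_mulr; case: j ltj le_jk p'j => [|j] _ _ p'j; first by rewrite dvdn0 in p'j.
rewrite -(Gauss_dvdr _ (n := j.+1)) ?prime_coprime //.
case: (n %/ p * p)%N (dvdn_mull (n %/ p) (dvdnn p)) => [|m] p_m.
  by rewrite bin0n muln0.
by rewrite -mul_bin_diag /= dvdn_mulr.
Qed.

Section HalfChebyshev.
Variable R : comNzRingType.
Implicit Types w : R.

(* With w = y + 1/y this is y^n - y^(n-1) + ... + y^(-n). *)
Definition halfcheb w n : R := \sum_(k < n.+1) (w - 2) ^+ k *+ 'C(n + k, 2 * k).

Lemma halfcheb_widen w n m : (n < m)%N ->
  halfcheb w n = \sum_(k < m) (w - 2) ^+ k *+ 'C(n + k, 2 * k).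
Proof.
move=> lt_nm.
rewrite /halfcheb (big_ord_widen _ (fun k => (w - 2) ^+ k *+ 'C(n + k, 2 * k)) lt_nm).
rewrite big_mkcond; apply: eq_bigr => k _; case: ltnP => // lt_nk.
by rewrite bin_small ?mulr0n //; lia.
Qed.

Lemma halfcheb0 w : halfcheb w 0 = 1.
Proof. by rewrite /halfcheb big_ord1 expr0 bin0. Qed.

Lemma halfcheb1 w : halfcheb w 1 = w - 1.
Proof. by rewrite /halfcheb !big_ord_recl big_ord0 /= /bump /= !bin0 !binn; ring. Qed.

(** In the form [V_(n+2) - 2 V_(n+1) + V_n = (w-2) V_(n+1)] this compares coefficients of powers of
    [w - 2]: by Pascal's rule the second difference in [n] of [C(n+k, 2k)] is [C(n+k, 2k-2)]. *)
Lemma halfchebSS w n : w * halfcheb w n.+1 = halfcheb w n.+2 + halfcheb w n.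
Proof.
suff: halfcheb w n.+2 + halfcheb w n = halfcheb w n.+1 *+ 2 + (w - 2) * halfcheb w n.+1.
  by move->; ring.
have E m : (m < n.+3)%N -> halfcheb w m =
    1 + \sum_(j < n.+2) (w - 2) ^+ j.+1 *+ 'C((m + j).+1, (2 * j).+2).
  move=> lt_m; rewrite (halfcheb_widen _ lt_m) big_ord_recl /= muln0 bin0.
  congr (_ + _); apply: eq_bigr => j _; rewrite /bump /= add1n.
  by rewrite addnS mulnS.
have D : (w - 2) * halfcheb w n.+1 =
    \sum_(j < n.+2) (w - 2) ^+ j.+1 *+ 'C(n.+1 + j, 2 * j).
  rewrite (@halfcheb_widen _ _ n.+2) // mulr_sumr; apply: eq_bigr => j _.
  by rewrite mulrnAr -exprS.
rewrite D !E //; first last.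
  by lia.
rewrite mulrnDl addrACA -[RHS]addrA; congr (_ + _).
rewrite -sumrMnl -!big_split /=; apply: eq_bigr => j _.
rewrite -mulrnA -!mulrnDr; congr (_ *+ _).
by rewrite !addSn !binS; lia.
Qed.

(** The case [y = -1], where all [2n+1] terms of the alternating sum agree. It supplies the
    coefficients in Jacobi's expansion of [E^3]. *)
Lemma halfchebN2 n : halfcheb (- 2) n = (-1) ^+ n * (2 * n + 1)%:R :> R.
Proof.
elim/ltn_ind: n => -[|[|n]] IH; first by rewrite halfcheb0 muln0 mul1r.
  by rewrite halfcheb1 expr1 muln1; ring.
move/eqP: (halfchebSS (- 2) n); rewrite (IH n.+1) // (IH n) // -subr_eq eq_sym.
by move=> /eqP ->; rewrite !exprS !natrD !natrM -!natr1; ring.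
Qed.

End HalfChebyshev.

Lemma rmorph_halfcheb (R S : comNzRingType) (f : {rmorphism R -> S}) w n :
  f (halfcheb w n) = halfcheb (f w) n.
Proof.
rewrite /halfcheb rmorph_sum; apply: eq_bigr => k _.
by rewrite rmorphMn rmorphXn rmorphB rmorph_nat.
Qed.

(** The coefficient is a sum over [k] of [C(n+k, 2k) * C(k, t)] up to sign. If [k = -1] mod [p],
    then [n+k] and [2k] have residues [n %% p - 1] and [p - 2], so the first binomial vanishes mod
    [p]. For any other [k], [k %% p < p - 1 = t %% p] and the second one does. *)
Lemma coef_halfcheb_eq0 (R : comNzRingType) p n t : p \in [pchar R] -> (t %% p)%N = p.-1 ->
  ~~ (p %| n * n.+1)%N -> (halfcheb (1 + 'X : {poly R}) n)`_t = 0.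
Proof.
move=> pR tp; have [p_pr /eqP p0] := andP pR; have p_gt1 := prime_gt1 p_pr.
have dvd0 (x : R) q : (p %| q)%N -> x *+ q = 0.
  by move=> /dvdnP[m ->]; rewrite -mulr_natr natrM p0 !mulr0.
rewrite Euclid_dvdM // negb_or => /andP[p'n p'n1].
have n_gt0 : (0 < n %% p)%N by rewrite lt0n.
have n_lt : (n %% p < p.-1)%N.
  have: (n %% p < p)%N by rewrite ltn_mod; lia.
  rewrite -{2}(prednK (ltnW p_gt1)) ltnS leq_eqVlt => /orP[/eqP np|//].
  by case/negP: p'n1; rewrite /dvdn -addn1 -modnDml np addn1 prednK ?modnn //; lia.
rewrite coef_sum big1 // => k _; rewrite coefMn.
have [kp | k'p] := eqVneq (k %% p)%N p.-1.
  apply/dvd0/prime_dvd_bin_mod => //.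
  have -> : ((n + k) %% p = (n %% p).-1)%N.
    rewrite -modnDm kp -subn1 addnBA; last by lia.
    by rewrite addnC -addnBA // modnDl modn_small; lia.
  have -> : (2 * k %% p = p - 2)%N.
    rewrite -modnMmr kp; have -> : (2 * p.-1 = p + (p - 2))%N by lia.
    by rewrite modnDl modn_small; lia.
  by lia.
have kp : (k %% p < t %% p)%N.
  by have := ltn_pmod k (ltnW p_gt1); rewrite tp; move/eqP: k'p; lia.
have -> : 1 + 'X - 2 = 'X + (-1)%:P :> {poly R}.
  by rewrite polyCN polyC1; ring.
rewrite exprDn coef_sum big1 ?mul0rn // => i _.
rewrite coefMn -rmorphXn coefMC coefXn.
have [et|] := eqVneq t (k - i)%N; last by rewrite mul0r mul0rn.
apply/dvd0; have le_ik : (i <= k)%N := ltn_ord i; rewrite -(bin_sub le_ik).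
by apply: prime_dvd_bin_mod => //; rewrite -?et.
Qed.

(** * The finite triple product *)

Section QBinomial.
Variables (R : comNzRingType) (q : R).

(** Gaussian binomials, defined by a q-Pascal rule so that they exist in any commutative ring
    without dividing by [1 - q^i]. *)
Fixpoint qbinom n k : R :=
  match n, k with
  | _, 0 => 1
  | 0, _.+1 => 0
  | n'.+1, k'.+1 => qbinom n' k' + q ^+ k * qbinom n' k
  end.

Arguments qbinom : simpl never.

Lemma qbinom0 n : qbinom n 0 = 1. Proof. by case: n. Qed.

Lemma qbinomS n k : qbinom n.+1 k.+1 = qbinom n k + q ^+ k.+1 * qbinom n k.+1.
Proof. by []. Qed.

Lemma qbinom_small n k : (n < k)%N -> qbinom n k = 0.
Proof.
elim: n k => [|n IHn] [|k] // lt_nk.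
by rewrite qbinomS !IHn ?(ltnW lt_nk) // mulr0 addr0.
Qed.

Lemma qbinomn n : qbinom n n = 1.
Proof. by elim: n => // n IHn; rewrite qbinomS IHn qbinom_small // mulr0 addr0. Qed.

(** The other q-Pascal rule. Together with the defining one it yields the symmetry [qbinom_sub] and
    the two-step recurrence [qbinomSS]. *)
Lemma qbinomSl n k : (k <= n)%N ->
  qbinom n.+1 k.+1 = q ^+ (n - k) * qbinom n k + qbinom n k.+1.
Proof.
elim: n k => [|n IHn] [|k] // le_kn.
- by rewrite qbinomS qbinom0 qbinom_small // expr0; ring.
- rewrite (qbinomS n.+1) [in LHS](IHn 0%N) // (qbinomS n) !qbinom0 !subn0 expr1 exprS.
  by ring.
rewrite (qbinomS n.+1) [in LHS](IHn k) // (qbinomS n k) [in RHS](qbinomS n k.+1) subSS.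
have [lt_kn | lt_nk | ->] := ltngtP k n.
- rewrite (IHn k.+1) //.
  have -> : (n - k = (n - k.+1).+1)%N by lia.
  by rewrite !exprS; ring.
- by lia.
- by rewrite subnn !qbinomn !qbinom_small // expr0; ring.
Qed.

Lemma qbinom_sub n k : (k <= n)%N -> qbinom n (n - k) = qbinom n k.
Proof.
elim: n k => [|n IHn] [|k] // le_kn; first by rewrite subn0 qbinomn.
have [-> | neq_kn] := eqVneq k n; first by rewrite subnn qbinom0 qbinomn.
have lt_kn : (k < n)%N by lia.
have e : (n - k = (n - k.+1).+1)%N by lia.
rewrite subSS e (@qbinomSl n) ?leq_subr // -e qbinomS IHn // IHn // subKn //.
by rewrite addrC.
Qed.

Lemma qbinom_prod n k :
  qbinom n k * \prod_(i < k) (1 - q ^+ i.+1) = \prod_(i < k) (1 - q ^+ (n - i)).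
Proof.
elim: n k => [|n IHn] [|k]; rewrite ?qbinom0 ?big_ord0 ?mulr1 //.
  by rewrite mul0r big_ord_recl subrr mul0r.
rewrite qbinomS mulrDl {1}big_ord_recr /= mulrA IHn -mulrA IHn.
rewrite big_ord_recr [RHS]big_ord_recl /= subn0.
under [X in _ = _ * X]eq_bigr => i _ do rewrite /bump add1n subSS.
have [lt_nk | le_kn] := ltnP n k.
  have -> : \prod_(i < k) (1 - q ^+ (n - i)) = 0; last by rewrite !mul0r !mulr0 addr0.
  by rewrite (bigD1 (Ordinal lt_nk)) //= subnn subrr mul0r.
have -> : n.+1 = (k.+1 + (n - k))%N by lia.
by rewrite exprD; ring.
Qed.

(** One rule of each kind is applied. With [n = 2N+1] this is the passage from [N] to [N+1] in the
    finite triple product. *)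
Lemma qbinomSS n j : (j < n)%N -> qbinom n.+2 j.+2 =
  (1 + q ^+ n.+1) * qbinom n j.+1 + q ^+ (n - j) * qbinom n j
  + q ^+ j.+2 * qbinom n j.+2.
Proof.
move=> lt_jn; rewrite qbinomS (@qbinomSl n j) ?(ltnW lt_jn) // (@qbinomSl n j.+1) //.
have -> : n.+1 = (j.+2 + (n - j.+1))%N by lia.
by rewrite exprD; ring.
Qed.

Lemma qbinomSS0 n : (0 < n)%N ->
  qbinom n.+2 1 = 1 + q ^+ n.+1 + q * qbinom n 1.
Proof.
by move=> n_gt0; rewrite qbinomS (@qbinomSl n 0) // !qbinom0 subn0 expr1 exprS; ring.
Qed.

(** Multiplication by [w] shifts the index of [V_n] up and down. At the boundary
    [w V_0 = V_1 + V_0], as if [V_(-1) = V_0]; hence [V_0] receives [g 0] in addition to [g 1]. *)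
Lemma sum_mul_halfcheb w (g : nat -> R) N : (forall n, (N < n)%N -> g n = 0) ->
  w * \sum_(n < N.+1) g n * halfcheb w n =
  (g 0%N + g 1%N) + \sum_(n < N.+1) (g n + g n.+2) * halfcheb w n.+1.
Proof.
move=> g0.
rewrite big_ord_recl mulrDr [w * \sum_(i < N) _]mulr_sumr.
under [X in _ + X = _]eq_bigr => i _ do rewrite lift0 mulrCA halfchebSS mulrDr.
rewrite big_split /= halfcheb0.
under [X in _ = _ + X]eq_bigr => i _ do rewrite mulrDl.
rewrite [X in _ = _ + X]big_split /=.
rewrite [X in _ = _ + (X + _)]big_ord_recl /= halfcheb1.
have -> : \sum_(i < N.+1) g i.+2 * halfcheb w i.+1 =
    \sum_(i < N) g i.+1 * halfcheb w i - g 1%N.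
  apply/eqP; rewrite eq_sym subr_eq eq_sym addrC; apply/eqP.
  transitivity (\sum_(i < N.+2) g i.+1 * halfcheb w i).
    by rewrite [RHS]big_ord_recl /= halfcheb0 mulr1.
  by rewrite !big_ord_recr /= !g0 // !mul0r !addr0.
ring.
Qed.

(* Cauchy's finite form of the Jacobi triple product. *)
Lemma finite_triple_product w N :
  \prod_(k < N) (1 + w * q ^+ k.+1 + q ^+ (2 * k.+1)) =
  \sum_(n < N.+1) q ^+ 'C(n.+1, 2) * qbinom (2 * N + 1) (N - n) * halfcheb w n.
Proof.
elim: N => [|N IHN].
  by rewrite big_ord0 big_ord1 bin_small // subn0 qbinom0 halfcheb0; ring.
rewrite big_ord_recr /= IHN.
(* The cut-off at [N] is essential: [N - n] is truncated, so the raw formula would not vanish for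
   [n > N]. *)
pose g n := if (n <= N)%N then q ^+ 'C(n.+1, 2) * qbinom (2 * N + 1) (N - n) else 0.
have g0 n : (N < n)%N -> g n = 0 by rewrite /g ltnNge => /negPf ->.
have -> : \sum_(n < N.+1) q ^+ 'C(n.+1, 2) * qbinom (2 * N + 1) (N - n) * halfcheb w n =
    \sum_(n < N.+1) g n * halfcheb w n.
  by apply: eq_bigr => n _; rewrite /g -ltnS ltn_ord.
set F := \sum_(n < N.+1) _.
transitivity ((1 + q ^+ (2 * N.+1)) * F + q ^+ N.+1 * (w * F)); first by ring.
rewrite {2}/F (sum_mul_halfcheb _ g0).
have -> : F = g 0%N + \sum_(n < N.+1) g n.+1 * halfcheb w n.+1.
  by rewrite big_ord_recr /= (g0 N.+1) // mul0r addr0 /F big_ord_recl halfcheb0 mulr1.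
rewrite [RHS]big_ord_recl halfcheb0 (mulrDr (1 + _)) (mulrDr (q ^+ N.+1) (g 0%N + g 1%N)).
rewrite [_ * \sum_(i < N.+1) g i.+1 * _]mulr_sumr.
rewrite [q ^+ N.+1 * \sum_(i < N.+1) _]mulr_sumr addrACA -big_split.
have e2N : (2 * N.+1 = (2 * N + 1).+1)%N by lia.
have e2N1 : (2 * N.+1 + 1 = (2 * N + 1).+2)%N by lia.
(* Coefficients are now compared, first that of [V_0], then that of each [V_(n+1)]. *)
rewrite e2N1 e2N; congr (_ + _).
  rewrite [q ^+ 'C(1, 2)]expr0 mulr1 [1 * _]mul1r [(N.+1 - ord0)%N]subn0.
  have {}e : (2 * N + 1 - N = N.+1)%N by lia.
  have lt_N : (N < 2 * N + 1)%N by lia.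
  (* The recurrence produces the entry just past the middle of row [2N+1]; by symmetry it equals the
     entry at [N], which is the extra [g 0] from the boundary. *)
  have := qbinom_sub (ltnW lt_N); rewrite e => sym.
  rewrite /g subn0 bin_small // expr0 mul1r leq0n.
  case: N {IHN g g0 F e2N e2N1} e lt_N sym => [|N] e lt_N sym.
    by rewrite qbinomSS0 // sym !qbinom0 ltnn; ring.
  have lt : (N < 2 * N.+1 + 1)%N by lia.
  rewrite (qbinomSS lt) sym subSS subn0 /= ?bin2 /=.
  have -> : (2 * N.+1 + 1 - N = N.+2.+1)%N by lia.
  by rewrite (exprS q N.+2); ring.
apply: eq_bigr => n _; rewrite lift0 subSS /= !mulrA -mulrDl; congr (_ * _).
have le_nN : (n <= N)%N := ltn_ord n.
move: (nat_of_ord n) le_nN => {}n le_nN.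
rewrite (binS n.+1) bin1 exprD /g le_nN.
(* The cases are: both [g n.+1] and [g n.+2] cut off, only [g n.+2] cut off, and the generic one. *)
case E: (N - n)%N => [|[|j]].
- have e : N = n :> nat by lia.
  by rewrite e ltnn ltnNge leqnSn /= !qbinom0; ring.
- have -> : N = n.+1 :> nat by lia.
  rewrite leqnn ltnn subnn qbinomSS0; last by lia.
  rewrite (binS n.+1) bin1 exprD !qbinom0 (exprS q n.+1); ring.
have e : N = (n + j).+2 :> nat by lia.
have [-> ->] : (n < N)%N /\ (n.+1 < N)%N by lia.
have -> : (N - n.+1 = j.+1)%N by lia.
have -> : (N - n.+2 = j)%N by lia.
rewrite qbinomSS; last by lia.
rewrite (binS n.+2) bin1 exprD (binS n.+1) bin1 exprD.
have -> : (2 * N + 1 - j = N.+1 + n.+2)%N by lia.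
have -> : (N.+1 = j.+2 + n.+1)%N by lia.
by rewrite !exprD; ring.
Qed.

End QBinomial.

Arguments qbinom : simpl never.

Lemma rmorph_qbinom (R S : comNzRingType) (f : {rmorphism R -> S}) q n k :
  f (qbinom q n k) = qbinom (f q) n k.
Proof.
elim: n k => [|n IHn] [|k]; try by rewrite !qbinom0 rmorph1.
  by rewrite !qbinom_small ?rmorph0.
by rewrite !qbinomS rmorphD rmorphM rmorphXn !IHn.
Qed.

(** * Truncated identities for Euler products *)

Section Truncation.
Variable R : comNzRingType.
Implicit Types f g : fps R.

(** Congruence modulo [q^N]; infinite sums and products are handled through their finite
    truncations. *)
Definition eq_upto N f g := forall n, (n < N)%N -> f n = g n.

Lemma eq_upto_refl N f : eq_upto N f f. Proof. by []. Qed.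

Lemma eq_upto_sym N f g : eq_upto N f g -> eq_upto N g f.
Proof. by move=> fg n /fg. Qed.

Lemma eq_upto_trans N f g h : eq_upto N f g -> eq_upto N g h -> eq_upto N f h.
Proof. by move=> fg gh n lt_n; rewrite fg ?gh. Qed.

Lemma eq_uptoW M N f g : (M <= N)%N -> eq_upto N f g -> eq_upto M f g.
Proof. by move=> le_MN fg n lt_n; rewrite fg // (leq_trans lt_n). Qed.

Lemma eq_uptoM N f f' g g' :
  eq_upto N f f' -> eq_upto N g g' -> eq_upto N (f * g) (f' * g').
Proof.
move=> ff gg n lt_n; rewrite !coef_fpsM; apply: eq_bigr => i _.
by rewrite ff ?gg // (leq_ltn_trans _ lt_n) ?leq_subr // -ltnS.
Qed.

Lemma eq_upto_sum N (I : finType) (F G : I -> fps R) :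
  (forall i, eq_upto N (F i) (G i)) -> eq_upto N (\sum_i F i) (\sum_i G i).
Proof.
by move=> FG n lt_n; rewrite !coef_fps_sum; apply: eq_bigr => i _; apply: FG.
Qed.

Lemma eq_upto_prod N (I : finType) (F G : I -> fps R) :
  (forall i, eq_upto N (F i) (G i)) -> eq_upto N (\prod_i F i) (\prod_i G i).
Proof. by move=> FG; elim/big_ind2: _ => // *; apply: eq_uptoM. Qed.

Lemma eq_upto_prod1 N (I : finType) (F : I -> fps R) :
  (forall i, eq_upto N (F i) 1) -> eq_upto N (\prod_i F i) 1.
Proof. by move=> F1; have := eq_upto_prod F1; rewrite big1_eq. Qed.

Lemma eq_upto_XnM m N f g :
  eq_upto N f g -> eq_upto (m + N) (fpsX ^+ m * f) (fpsX ^+ m * g).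
Proof.
move=> fg n lt_n; rewrite !coef_fpsXnM; case: leqP => // le_mn.
by apply: fg; lia.
Qed.

Lemma eq_upto_1subXn N m : (N <= m)%N -> eq_upto N (1 - fpsX ^+ m) 1.
Proof.
move=> le_Nm n lt_n; rewrite coef_fpsD coef_fpsN coef_fpsXn.
by rewrite (ltn_eqF (leq_trans lt_n le_Nm)) subr0.
Qed.

Definition qpoch (q : fps R) N : fps R := \prod_(i < N) (1 - q ^+ i.+1).

Lemma eq_upto_qpoch d M N : (0 < d)%N -> (M <= N)%N ->
  eq_upto M.+1 (qpoch (fpsX ^+ d) N) (qpoch (fpsX ^+ d) M).
Proof.
move=> d_gt0 le_MN; rewrite -(subnKC le_MN) /qpoch big_split_ord /=.
rewrite -[X in eq_upto _ _ X]mulr1; apply: eq_uptoM => //.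
apply: eq_upto_prod1 => i; rewrite -exprM; apply: eq_upto_1subXn.
by nia.
Qed.

(* The factors 1 - q^(di) with i > n do not affect the coefficient of q^n. *)
Definition euler d : fps R := Fps (fun n => qpoch (fpsX ^+ d) n n).

Lemma eq_upto_euler d N : (0 < d)%N ->
  eq_upto N.+1 (euler d) (qpoch (fpsX ^+ d) N).
Proof. by move=> d_gt0 n le_n /=; rewrite (@eq_upto_qpoch d n N). Qed.

(** To this precision [E] may be cut to its first [N - n] factors, the denominator of the Gaussian
    binomial. What remains is its numerator, whose factors [1 - q^(d(2N+1-i))] with [i < N - n] are
    all 1 to this order. *)
Lemma euler_qbinom d n N : (0 < d)%N -> (n <= N)%N ->
  eq_upto (N - n).+1 (euler d * qbinom (fpsX ^+ d) (2 * N + 1) (N - n)) 1.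
Proof.
move=> d_gt0 le_nN.
apply: (@eq_upto_trans _ _ (qpoch (fpsX ^+ d) (N - n) * qbinom (fpsX ^+ d) (2 * N + 1) (N - n))).
  by apply: eq_uptoM => //; apply: eq_upto_euler.
rewrite mulrC /qpoch qbinom_prod.
apply: eq_upto_prod1 => i; rewrite -exprM; apply: eq_upto_1subXn.
by have := ltn_ord i; nia.
Qed.

Lemma leq_triangular n : (n <= 'C(n.+1, 2))%N.
Proof. by rewrite binS bin1 leq_addl. Qed.

(** [euler_qbinom] loses [n] orders of precision in the [n]-th term; the factor [q^(d C(n+1,2))]
    restores them, since [C(n+1,2) >= n]. The arbitrary [v] allows both values of [V_n] and
    coefficients of [V_n(1+z)]. *)
Lemma euler_mul_qbinom_sum d (v : nat -> fps R) N : (0 < d)%N ->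
  eq_upto N.+1
    (euler d * \sum_(n < N.+1)
       (fpsX ^+ d) ^+ 'C(n.+1, 2) * qbinom (fpsX ^+ d) (2 * N + 1) (N - n) * v n)
    (\sum_(n < N.+1) fpsX ^+ (d * 'C(n.+1, 2)) * v n).
Proof.
move=> d_gt0; rewrite mulr_sumr; apply: eq_upto_sum => n.
have le_nN : (n <= N)%N := ltn_ord n; rewrite -exprM -mulrA mulrCA.
apply: (@eq_uptoW _ (d * 'C(n.+1, 2) + (N - n).+1)).
  by have := leq_triangular n; nia.
apply: eq_upto_XnM; rewrite mulrA -[X in eq_upto _ _ X]mul1r.
by apply: eq_uptoM => //; apply: euler_qbinom.
Qed.

Lemma triple_product d (w : fps R) N : (0 < d)%N ->
  eq_upto N.+1
    (euler d * \prod_(k < N) (1 + w * fpsX ^+ (d * k.+1) + fpsX ^+ (d * (2 * k.+1))))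
    (\sum_(n < N.+1) fpsX ^+ (d * 'C(n.+1, 2)) * halfcheb w n).
Proof.
move=> d_gt0; have := finite_triple_product (fpsX ^+ d) w N.
under eq_bigr => k _ do rewrite -!exprM.
by move=> ->; apply: euler_mul_qbinom_sum.
Qed.

(** Jacobi's identity, from the triple product at [w = -2], where each factor becomes
    [(1 - q^(dk))^2]. *)
Lemma euler_cubed_eq_upto d N : (0 < d)%N ->
  eq_upto N.+1 (euler d ^+ 3)
    (\sum_(n < N.+1) fpsX ^+ (d * 'C(n.+1, 2)) * ((-1) ^+ n * (2 * n + 1)%:R)).
Proof.
move=> d_gt0; have := @triple_product d (- 2) N d_gt0.
under [X in _ -> eq_upto _ _ X]eq_bigr => n _ do rewrite -halfchebN2.
apply: eq_upto_trans; rewrite exprS; apply: eq_uptoM => //.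
have -> : \prod_(k < N) (1 + - 2 * fpsX ^+ (d * k.+1) + fpsX ^+ (d * (2 * k.+1))) =
    qpoch (fpsX ^+ d) N * qpoch (fpsX ^+ d) N :> fps R.
  rewrite -big_split /=; apply: eq_bigr => k _; rewrite -exprM.
  have -> : (d * (2 * k.+1) = d * k.+1 + d * k.+1)%N by lia.
  by rewrite exprD; ring.
by rewrite expr2; apply: eq_uptoM; apply: eq_upto_euler.
Qed.

Lemma euler3_factor N :
  eq_upto N.+1 (euler 3) (euler 1 * \prod_(k < N) (1 + fpsX ^+ k.+1 + fpsX ^+ (2 * k.+1))).
Proof.
apply: eq_upto_trans (@eq_upto_euler _ N _) _ => //.
apply/eq_upto_sym; apply: eq_upto_trans (eq_uptoM (@eq_upto_euler _ N _) (eq_upto_refl _)) _ => //.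
rewrite /qpoch -big_split /=; apply: eq_upto_prod => k n _; congr (fps_coef _ n).
rewrite -!exprM mul1n mulSn mul1n; have -> : (3 * k.+1 = k.+1 + k.+1 + k.+1)%N by lia.
by rewrite !exprD; ring.
Qed.

(** The triple product at [w = 1]. It acts as the pentagonal number theorem in [q^3]: three times a
    pentagonal number is triangular. *)
Lemma euler3_eq_upto N :
  eq_upto N.+1 (euler 3) (\sum_(n < N.+1) fpsX ^+ 'C(n.+1, 2) * halfcheb 1 n).
Proof.
apply: eq_upto_trans (@euler3_factor N) _.
have := @triple_product 1 1 N isT.
under [X in eq_upto _ _ X -> _]eq_bigr => n _ do rewrite mul1n.
by under [X in eq_upto _ (_ * X) _ -> _]eq_bigr => k _ do rewrite mul1r !mul1n.
Qed.

End Truncation.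

(** * The generating series of MO *)

Lemma coef_prod_1addX (R : comNzRingType) (I : finType) (x : I -> R) t :
  (\prod_i (1 + (x i)%:P * 'X))`_t = \sum_(J : {set I} | #|J| == t) \prod_(i in J) x i.
Proof.
under eq_bigr => i _ do rewrite addrC.
rewrite bigA_distr coef_sum [RHS]big_mkcond; apply: eq_bigr => J _.
rewrite -big_mkcond big_split prodr_const /= -rmorph_prod coefCM coefXn eq_sym.
by case: eqP; rewrite ?mulr1 ?mulr0.
Qed.

Section MOSeries.
Variable a : int.

Lemma MO_term_prod t (s : t.-tuple nat) : MO_index s ->
  MO_term a s = \prod_(m <- s) (fpsX ^+ m / MO_den a m).
Proof.
rewrite /MO_index /= (path_sortedE ltn_trans) => /andP[/allP s_gt0 _].
rewrite big_split /= -expr_sum /MO_term; congr (_ * _).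
rewrite [in RHS]big_seq prodrV -?big_seq // => m /s_gt0; exact: MO_den_unit.
Qed.

(** Encodes the increasing tuples with entries from 1 to [N] as subsets of ['I_N]; the element [i]
    stands for the entry [i.+1]. *)
Definition set_seq N (J : {set 'I_N}) : seq nat := [seq (val i).+1 | i <- enum J].

Lemma set_seq_inj N : injective (@set_seq N).
Proof.
move=> J K eqJK; apply/setP => i.
have inj : injective (fun i : 'I_N => (i : nat).+1) by move=> j k [/val_inj].
by rewrite -(mem_enum (mem J)) -(mem_enum (mem K)) (inj_map inj eqJK).
Qed.

Lemma path_set_seq N (J : {set 'I_N}) : path ltn 0 (set_seq J).
Proof.
rewrite (path_sortedE ltn_trans); apply/andP; split.
  by apply/allP => _ /mapP[i _ ->].
rewrite sorted_map.
have : sorted (relpre val ltn) (enum 'I_N) by rewrite -sorted_map val_enum_ord iota_ltn_sorted.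
apply: subseq_sorted; first by move=> i j k; apply: ltn_trans.
by rewrite /enum_mem; rewrite [X in subseq _ X]filter_predT; apply: filter_subseq.
Qed.

(** A tuple contributing to [q^n] has sum at most [n], so its entries are at most [N]. The sum is
    then an elementary symmetric function of finitely many series, read off as the coefficient of
    ['X^t]. *)
Lemma MO_coef t n N : (n <= N)%N ->
  MO a t n = (\prod_(k < N) (1 + (fpsX ^+ k.+1 / MO_den a k.+1)%:P * 'X))`_t n.
Proof.
move=> le_nN; rewrite (@coef_prod_1addX _ _ (fun k : 'I_N => fpsX ^+ k.+1 / MO_den a k.+1)).
rewrite coef_fps_sum; have -> : MO a t n = \sum_(s \in @MO_index t) MO_term a s n by [].
(* The default tuple of zeros is taken only when [J] does not have [t] elements, and such [J] are
   excluded from [r]. *)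
pose tup (J : {set 'I_N}) : t.-tuple nat := insubd [tuple of nseq t 0%N] (set_seq J).
have tupE (J : {set 'I_N}) : #|J| == t -> tup J = set_seq J :> seq nat.
  by move=> cJ; rewrite insubdK // -topredE /= size_map -cardE.
pose r := [seq tup J | J <- enum (finset (fun J : {set 'I_N} => #|J| == t))].
have tup_index (J : {set 'I_N}) : #|J| == t -> MO_index (tup J).
  by move=> cJ; rewrite /MO_index /= tupE // path_set_seq.
rewrite (fsbigE r).
- rewrite big_map big_enum_cond big_mkcond [RHS]big_mkcond; apply: eq_bigr => J _.
  rewrite inE; case: ifP => [/andP[cJ _] | ncJ]; last first.
    by case: ifP => // cJ; move: ncJ; rewrite cJ mem_set //; apply: tup_index.
  rewrite cJ MO_term_prod; last exact: tup_index.
  by rewrite tupE // big_map big_enum.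
- rewrite map_inj_in_uniq ?enum_uniq // => J K; rewrite !mem_enum !inE => cJ cK eqJK.
  by apply: set_seq_inj; rewrite -!tupE // eqJK.
- by move=> s /= /mapP[J]; rewrite mem_enum inE => cJ ->; apply: tup_index.
(* It remains to see that tuples outside [r] contribute 0: if the sum of [s] is at most [n], then
   [s] comes from a subset [J]. *)
move=> s s_idx /negP r's; rewrite /MO_term coef_fpsXnM; case: leqP => // le_sn.
case: r's; pose J := finset (fun i : 'I_N => i.+1 \in (s : seq nat)).
have eqJs : set_seq J = s.
  apply: (irr_sorted_eq ltn_trans ltnn).
  - exact: path_sorted (path_set_seq J).
  - exact: path_sorted s_idx.
  move=> m; apply/mapP/idP => [[i] | sm]; first by rewrite mem_enum inE => si ->.
  have m_gt0 : (0 < m)%N.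
    have : path ltn 0 s := s_idx.
    by rewrite (path_sortedE ltn_trans) => /andP[/allP/(_ m sm)].
  have lt_mN : (m.-1 < N)%N.
    rewrite prednK // (leq_trans _ le_nN) // (leq_trans _ le_sn) //.
    by rewrite (big_rem m) //= leq_addr.
  by exists (Ordinal lt_mN); rewrite ?mem_enum ?inE /= prednK.
have cJ : #|J| == t.
  by rewrite cardE -(size_map (fun i : 'I_N => (i : nat).+1)) -/(set_seq J) eqJs size_tuple.
apply/mapP; exists J; first by rewrite mem_enum inE.
by apply: val_inj; rewrite /= tupE.
Qed.

End MOSeries.

Definition MO_series t : fps int := Fps (MO 1 t).

(** Each factor splits as [1 + (1+z) q^k + q^(2k) = D_k (1 + z q^k / D_k)] with [D_k = MO_den 1 k].
    The product of the [D_k] turns [E(q)] into [E(q^3)], and the other factors generate [MO]. *)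
Lemma euler3_mul_MO_series t N :
  eq_upto N.+1 (euler int 3 * MO_series t)
    (\sum_(n < N.+1) fpsX ^+ 'C(n.+1, 2) * (halfcheb (1 + 'X : {poly fps int}) n)`_t).
Proof.
pose e := (\prod_(k < N) (1 + (fpsX ^+ k.+1 / MO_den 1 k.+1)%:P * 'X))`_t.
apply: (@eq_upto_trans _ _ _ (euler int 3 * e)).
  by apply: eq_uptoM => // n le_n; rewrite -(@MO_coef 1 t n N).
have := @euler_mul_qbinom_sum int 1 (fun n => (halfcheb (1 + 'X : {poly fps int}) n)`_t) N isT.
under [X in eq_upto _ _ X -> _]eq_bigr => n _ do rewrite mul1n.
apply: eq_upto_trans.
have -> : \sum_(n < N.+1) (fpsX ^+ 1) ^+ 'C(n.+1, 2) * qbinom (fpsX ^+ 1) (2 * N + 1) (N - n) *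
      (halfcheb (1 + 'X : {poly fps int}) n)`_t =
    (\prod_(k < N) MO_den 1 k.+1) * e.
  (* The finite triple product is used over [{poly fps int}] with [w = 1 + 'X]; the coefficient of
     ['X^t] is taken before [N] grows, so truncation is needed only in [fps int]. *)
  transitivity (\prod_(k < N)
      (1 + (1 + 'X) * fpsX%:P ^+ k.+1 + fpsX%:P ^+ (2 * k.+1)) : {poly fps int})`_t.
    rewrite finite_triple_product coef_sum; apply: eq_bigr => n _.
    by rewrite expr1 -(rmorph_qbinom polyC) -rmorphXn -rmorphM coefCM.
  rewrite /e -coefCM rmorph_prod -big_split.
  apply: (congr1 (fun p : {poly fps int} => p`_t)); apply: eq_bigr => k _ /=.
  rewrite mulrDr mulr1 mulrA -rmorphM [MO_den _ _ * (_ / _)]mulrC divrK; last exact: MO_den_unit.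
  rewrite /MO_den; have -> : fpsC 1 = 1 :> fps int by apply: fpsP => n.
  by rewrite mul1r !rmorphD rmorph1 !rmorphXn; ring.
rewrite mulrA; apply: eq_uptoM => //; apply: eq_upto_trans (@euler3_factor int N) _.
apply: eq_uptoM => //; apply: eq_upto_prod => k n _; congr (fps_coef _ n).
by rewrite /MO_den; have -> : fpsC 1 = 1 :> fps int; [apply: fpsP | rewrite mul1r].
Qed.

(** * Reduction modulo a prime *)

Section FpsC.
Variable R : comNzRingType.

Fact fpsC_is_zmod_morphism : zmod_morphism (@fpsC R).
Proof. by move=> a b; apply: fpsP => n /=; rewrite mulrnBl. Qed.

Fact fpsC_is_monoid_morphism : monoid_morphism (@fpsC R).
Proof.
split=> [|a b]; first exact: fpsP.
by apply: fpsP => n; rewrite coef_fpsCM /= mulrnAr.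
Qed.

HB.instance Definition _ := GRing.isZmodMorphism.Build R (fps R) (@fpsC R)
  fpsC_is_zmod_morphism.
HB.instance Definition _ := GRing.isMonoidMorphism.Build R (fps R) (@fpsC R)
  fpsC_is_monoid_morphism.

Lemma coef_fpsXnMC m c n : (fpsX ^+ m * fpsC c) n = c *+ (n == m) :> R.
Proof. by rewrite mulrC coef_fpsCM coef_fpsXn mulr_natr. Qed.

End FpsC.

Section FpsMap.
Variables (R S : comNzRingType) (f : {rmorphism R -> S}).

Definition fps_map (g : fps R) : fps S := Fps (fun n => f (g n)).

Fact fps_map_is_zmod_morphism : zmod_morphism fps_map.
Proof. by move=> g h; apply: fpsP => n /=; rewrite rmorphB. Qed.

Fact fps_map_is_monoid_morphism : monoid_morphism fps_map.
Proof.
split=> [|g h]; apply: fpsP => n /=; first by rewrite rmorph_nat.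
by rewrite rmorph_sum; apply: eq_bigr => i _; rewrite rmorphM.
Qed.

HB.instance Definition _ := GRing.isZmodMorphism.Build (fps R) (fps S) fps_map
  fps_map_is_zmod_morphism.
HB.instance Definition _ := GRing.isMonoidMorphism.Build (fps R) (fps S) fps_map
  fps_map_is_monoid_morphism.

Lemma fps_map_euler d : fps_map (euler R d) = euler S d.
Proof.
have mapX : fps_map fpsX = fpsX by apply: fpsP => n /=; rewrite rmorph_nat.
apply: fpsP => n; transitivity (fps_map (qpoch (fpsX ^+ d) n) n) => //.
rewrite -[RHS]/(qpoch (fpsX ^+ d) n n).
rewrite /qpoch rmorph_prod; apply: (congr1 (fun g : fps S => g n)). apply: eq_bigr => i _.
by rewrite rmorphB rmorph1 !rmorphXn /= mapX.
Qed.

End FpsMap.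

Lemma modn_dvd_sub p m n : (p %| m)%N -> (m <= n)%N -> n - m = n %[mod p].
Proof. by move=> /eqP pm le_mn; rewrite -{2}(subnK le_mn) -modnDmr pm addn0. Qed.

Lemma supp_mul_vanish (R : comNzRingType) p (f g : fps R) r :
  (forall n, f n != 0 -> (p %| n)%N) ->
  (forall n, (n %% p)%N = r -> g n = 0) ->
  forall n, (n %% p)%N = r -> (f * g) n = 0.
Proof.
move=> f_supp g0 n nr; rewrite coef_fpsM big1 // => i _.
have [-> | /f_supp p_i] := eqVneq (f i) 0; first by rewrite mul0r.
by rewrite g0 ?mulr0 // modn_dvd_sub // -ltnS.
Qed.

(** A series in [q^p] acts within each residue class of exponents; with constant term 1 it can be
    cancelled there, by strong induction on the exponent. *)
Lemma vanish_of_mul_supp (R : comNzRingType) p (f g : fps R) r :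
  g 0%N = 1 -> (forall n, g n != 0 -> (p %| n)%N) ->
  (forall n, (n %% p)%N = r -> (f * g) n = 0) ->
  forall n, (n %% p)%N = r -> f n = 0.
Proof.
move=> g0 g_supp fg0 n; elim/ltn_ind: n => n IHn nr.
have := fg0 n nr; rewrite mulrC coef_fpsM big_ord_recl g0 mul1r subn0 big1 ?addr0 // => i _.
have [-> | /g_supp p_i] := eqVneq (g (lift ord0 i)) 0; first by rewrite mul0r.
rewrite IHn ?mulr0 //; first by rewrite lift0; have := ltn_ord i; lia.
by rewrite modn_dvd_sub // lift0.
Qed.

Section CharP.
Variables (R : comNzRingType) (p : nat).
Hypothesis pR : p \in [pchar R].
Implicit Types f g : fps R.

Lemma euler3_supp n : euler R 3 n != 0 -> exists m, n = 'C(m.+1, 2).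
Proof.
rewrite (@euler3_eq_upto R n) // coef_fps_sum => nz.
have [/existsP[m /eqP ->]|/existsPn no] := boolP [exists m : 'I_n.+1, n == 'C(m.+1, 2)].
  by exists m.
case/eqP: nz; rewrite big1 // => m _.
by rewrite -(rmorph1 (@fpsC R)) -rmorph_halfcheb coef_fpsXnMC (negPf (no m)).
Qed.

(** The coefficient [2m+1] in Jacobi's identity is zero in characteristic [p] when [p] divides
    it. *)
Lemma euler3_cubed_supp n : (euler R 3 ^+ 3) n != 0 ->
  exists2 m, n = (3 * 'C(m.+1, 2))%N & ~~ (p %| 2 * m + 1)%N.
Proof.
rewrite (@euler_cubed_eq_upto R 3 n) // coef_fps_sum => nz.
pose P (m : 'I_n.+1) := (n == 3 * 'C(m.+1, 2))%N && ~~ (p %| 2 * m + 1)%N.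
have [/existsP[m /andP[/eqP em p'm]]|/existsPn no] := boolP [exists m, P m].
  by exists m.
case/eqP: nz; rewrite big1 // => m _.
have -> : (-1) ^+ m * (2 * m + 1)%:R = fpsC ((-1) ^+ m * (2 * m + 1)%:R) :> fps R.
  by rewrite rmorphM rmorphXn rmorphN rmorph1 rmorph_nat.
rewrite coef_fpsXnMC; have := no m; rewrite negb_and => /orP[/negPf -> // |].
by rewrite negbK (dvdn_pcharf pR) => /eqP ->; rewrite mulr0 mul0rn.
Qed.

Lemma fps_pchar : p \in [pchar (fps R)].
Proof.
have [p_pr /eqP p0] := andP pR; rewrite inE p_pr /=; apply/eqP.
by rewrite -(rmorph_nat (@fpsC R)) p0 rmorph0.
Qed.

Lemma fps_exp_pchar_supp f n : (f ^+ p) n != 0 -> (p %| n)%N.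
Proof.
have p_gt0 : (0 < p)%N := prime_gt0 (pcharf_prime pR).
(* Frobenius is additive on finite sums only, so [f] is first replaced by a polynomial
   truncation. *)
pose g : fps R := \sum_(i < n.+1) fpsC (f i) * fpsX ^+ i.
have fg : eq_upto n.+1 f g.
  move=> m lt_mn; rewrite /g coef_fps_sum (bigD1 (Ordinal lt_mn)) //.
  rewrite coef_fpsCM coef_fpsXn eqxx mulr1 big1 => [|i ne_im]; first by rewrite /= addr0.
  rewrite coef_fpsCM coef_fpsXn; suff /negPf -> : m != i by rewrite mulr0.
  by apply: contra ne_im => /eqP e; apply/eqP/val_inj.
have fgk k : eq_upto n.+1 (f ^+ k) (g ^+ k).
  by elim: k => // k IHk; rewrite !exprS; apply: eq_uptoM.
have gp : g ^+ p = \sum_(i < n.+1) fpsC (f i ^+ p) * fpsX ^+ (i * p).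
  rewrite -(GRing.pFrobenius_autE fps_pchar) rmorph_sum; apply: eq_bigr => i _ /=.
  by rewrite GRing.pFrobenius_autE exprMn exprM rmorphXn.
rewrite fgk // gp coef_fps_sum; apply: contraNT => p'n; rewrite big1 // => i _.
rewrite coef_fpsCM coef_fpsXn.
suff /negPf -> : n != (i * p)%N by rewrite mulr0.
by apply: contra p'n => /eqP {1}->; rewrite dvdn_mull.
Qed.

Lemma exp_mul_pchar_supp f k n : (f ^+ (p * k)) n != 0 -> (p %| n)%N.
Proof. by rewrite mulnC exprM; apply: fps_exp_pchar_supp. Qed.

End CharP.

Lemma euler_exp0 (R : comNzRingType) d k : (euler R d ^+ k) 0%N = 1.
Proof.
elim: k => // k IHk; rewrite exprS coef_fpsM big_ord1 /= IHk mulr1.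
by rewrite /qpoch big_ord0.
Qed.

(** The coefficient is a constant, free of [q]; hence the [n]-th term of the series stays
    concentrated in the exponent [C(n+1,2)]. *)
Lemma coef_halfcheb_fps (R : comNzRingType) n t :
  (halfcheb (1 + 'X : {poly fps R}) n)`_t = fpsC (halfcheb (1 + 'X : {poly R}) n)`_t.
Proof.
have -> : 1 + 'X = map_poly (@fpsC R) (1 + 'X) by rewrite rmorphD rmorph1 /= map_polyX.
by rewrite -(rmorph_halfcheb (map_poly (@fpsC R))) coef_map.
Qed.

Lemma euler3_mul_MO_series_supp p t n : prime p -> odd p -> (t %% p)%N = p.-1 ->
  (euler 'F_p 3 * fps_map (intmul 1) (MO_series t)) n != 0 -> (p %| n)%N.
Proof.
move=> p_pr p_odd tp; rewrite -(fps_map_euler (intmul 1)) -rmorphM.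
rewrite -[fps_coef _ n]/(intmul 1 ((euler int 3 * MO_series t) n)).
rewrite (@euler3_mul_MO_series t n) // coef_fps_sum rmorph_sum => nz.
apply: contraNT nz => p'n; rewrite big1 // => m _.
rewrite coef_halfcheb_fps coef_fpsXnMC rmorphMn /=.
case: eqP => [en|]; last by rewrite mulr0n.
rewrite mulr1n -(coef_map (intmul 1)) /= (rmorph_halfcheb (map_poly (intmul 1))).
rewrite rmorphD rmorph1 /= map_polyX (@coef_halfcheb_eq0 _ p) ?pchar_Fp //.
(* Since [p] is odd, divisibility of [m(m+1)] by [p] passes to the triangular number. *)
apply: contra p'n => p_m; rewrite en bin2 /=.
have := p_m; rewrite mulnC -{1}(odd_double_half (m.+1 * m)) oddM /= andNb add0n.
by rewrite -muln2 Euclid_dvdM // (gtnNdvd _ (odd_prime_gt2 p_odd p_pr)) // orbF.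
Qed.

(** With [E = E(q^3)] and [M] the series of [MO], write [E^(pk) M = E^(pk-1) (E M)]. As [E M] is a
    series in [q^p], class [r] of the right side vanishes; then [E^(pk)], also a series in [q^p], is
    cancelled. *)
Lemma MO_eq0_mod p k r t n : prime p -> odd p -> (0 < k)%N ->
  (forall m, (m %% p)%N = r -> (euler 'F_p 3 ^+ (p * k).-1) m = 0) ->
  (t %% p)%N = p.-1 -> (n %% p)%N = r -> (MO 1 t n = 0 %[mod p])%Z.
Proof.
move=> p_pr p_odd k_gt0 E0 tp nr; have pF := pchar_Fp p_pr.
apply/eqP; rewrite eqz_mod_dvd subr0 (dvdz_pcharf pF); apply/eqP.
rewrite -[_%:~R]/(fps_map (intmul 1) (MO_series t) n).
apply: (vanish_of_mul_supp (g := euler 'F_p 3 ^+ (p * k)) (p := p) _ _ _ nr).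
- exact: euler_exp0.
- exact: exp_mul_pchar_supp.
have pk_gt0 : (0 < p * k)%N by rewrite muln_gt0 prime_gt0.
move=> m mr; rewrite mulrC -(prednK pk_gt0) exprSr -mulrA mulrC.
apply: supp_mul_vanish mr => // i.
exact: euler3_mul_MO_series_supp.
Qed.

(** * Ramanujan's congruences *)

(** The explicit quotient makes every fact linear once [a %% p] is known, so that [lia] can settle
    the residue classes. *)
Lemma triangular_mod p a :
  exists w, (2 * 'C(a.+1, 2) = p * w + a %% p * (a %% p).+1)%N.
Proof.
have -> : (2 * 'C(a.+1, 2) = a * a.+1)%N.
  by rewrite bin2 /= mul2n -[RHS]mulnC -[RHS]odd_double_half oddM /= andNb.
set x := (a %% p)%N; set q := (a %/ p)%N.
(* For [a = p q + x], [a(a+1) - x(x+1) = p q (p q + 2x + 1)]. *)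
exists (q * (p * q + 2 * x + 1))%N; rewrite (divn_eq a p) -/x -/q; nia.
Qed.

(** In [E * E^3], exponents [C(a+1,2) + 3 C(b+1,2) = m] satisfy [(2a+1)^2 + 3 (2b+1)^2 = 8m + 4 = 0]
    mod 5. As -3 is a nonresidue, 5 divides [2b+1], and that term has coefficient 0. *)
Lemma euler3_exp4_vanish m : (m %% 5)%N = 2 -> (euler 'F_5 3 ^+ 4) m = 0.
Proof.
move=> m2; rewrite exprS coef_fpsM big1 // => i _.
have [-> | /euler3_supp[a ia]] := eqVneq (euler 'F_5 3 i) 0; first by rewrite mul0r.
have [-> | ] := eqVneq ((euler 'F_5 3 ^+ 3) (m - i)%N) 0; first by rewrite mulr0.
case/(euler3_cubed_supp (pchar_Fp (isT : prime 5))) => b ib /negP[].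
have le_im : (i <= m)%N := ltn_ord i.
have [[u eu] [v ev]] := (triangular_mod 5 a, triangular_mod 5 b).
have := ltn_pmod a (isT : 0 < 5)%N; have := ltn_pmod b (isT : 0 < 5)%N.
case Ex: (a %% 5)%N eu => [|[|[|[|[|//]]]]];
  case Ey: (b %% 5)%N ev => [|[|[|[|[|//]]]]]; lia.
Qed.

(** In [E^3 * E^3] the exponents satisfy [3 ((2a+1)^2 + (2b+1)^2) = 8m + 6 = 0] mod 7. As -1 is a
    nonresidue, 7 divides [2a+1] and [2b+1]. *)
Lemma euler3_exp6_vanish m : (m %% 7)%N = 1 -> (euler 'F_7 3 ^+ 6) m = 0.
Proof.
move=> m1; rewrite (exprD _ 3 3) coef_fpsM big1 // => i _.
have F7 := pchar_Fp (isT : prime 7).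
have [-> | ] := eqVneq ((euler 'F_7 3 ^+ 3) i) 0; first by rewrite mul0r.
case/(euler3_cubed_supp F7) => a ia p'a.
have [-> | ] := eqVneq ((euler 'F_7 3 ^+ 3) (m - i)%N) 0; first by rewrite mulr0.
case/(euler3_cubed_supp F7) => b ib /negP[]; move/negP: p'a => p'a.
have le_im : (i <= m)%N := ltn_ord i.
have [[u eu] [v ev]] := (triangular_mod 7 a, triangular_mod 7 b).
have := ltn_pmod a (isT : 0 < 7)%N; have := ltn_pmod b (isT : 0 < 7)%N.
case Ex: (a %% 7)%N eu => [|[|[|[|[|[|[|//]]]]]]];
  case Ey: (b %% 7)%N ev => [|[|[|[|[|[|[|//]]]]]]]; lia.
Qed.

(** * Dissection into residue classes and the modulus 11 *)

Definition class_part (R : comNzRingType) p (f : fps R) r : fps R :=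
  Fps (fun n => if (n %% p)%N == r then f n else 0).

Lemma coef_class_part (R : comNzRingType) p (f : fps R) r n :
  class_part p f r n = if (n %% p)%N == r then f n else 0.
Proof. by []. Qed.

(** Dissection turns products into convolutions over [Z/p]; [(r + (p - s)) %% p] is [r - s] there,
    free of truncated subtraction. *)
Lemma class_partM (R : comNzRingType) p (f g : fps R) r : (r < p)%N ->
  class_part p (f * g) r = \sum_(s < p) class_part p f s * class_part p g ((r + (p - s)) %% p)%N.
Proof.
move=> lt_rp; have p_gt0 := leq_ltn_trans (leq0n r) lt_rp.
apply: fpsP => n; rewrite coef_fps_sum.
under eq_bigr do rewrite coef_fpsM.
rewrite exchange_big /=.
have key (i : 'I_n.+1) (s : 'I_p) : (i %% p)%N = s ->
    ((n - i) %% p == (r + (p - s)) %% p)%N = (n %% p == r)%N.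
  move=> eis; have le_in : (i <= n)%N := ltn_ord i.
  rewrite -{2}(modn_small lt_rp) -(eqn_modDr s) -addnA subnK ?modnDr ?(ltnW (ltn_ord s)) //.
  by rewrite -eis modnDmr subnK.
case: (altP eqP) => [nr | nr].
  apply: eq_bigr => i _; pose s := Ordinal (ltn_pmod i p_gt0).
  have := key i s (erefl _); rewrite (bigD1 s) //= eqxx nr eqxx => ->.
  rewrite big1 ?addr0 // => s' ne.
  suff /negPf -> : (i %% p)%N != s' by rewrite mul0r.
  by apply: contra ne => /eqP e; apply/eqP/val_inj.
rewrite big1 // => i _; rewrite big1 // => s _.
by have [/key -> | _] := eqVneq (i %% p)%N s; rewrite ?(negPf nr) ?mulr0 ?mul0r.
Qed.

Lemma triangular11_mod m : ('C(m.+1, 2) %% 11 \in [:: 0; 1; 3; 6; 10; 4])%N.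
Proof.
have [u] := triangular_mod 11 m; have := ltn_pmod m (isT : 0 < 11)%N.
rewrite !inE.
case: (m %% 11)%N => [|[|[|[|[|[|[|[|[|[|[|//]]]]]]]]]]]; lia.
Qed.

(** The sixth class, [3 * 4 = 1] mod 11, occurs only for [m = 5] mod 11, that is, when 11 divides
    [2m+1]. *)
Lemma triple_triangular11_mod m : ~~ (11 %| 2 * m + 1)%N ->
  ((3 * 'C(m.+1, 2)) %% 11 \in [:: 0; 3; 9; 7; 8])%N.
Proof.
have [u] := triangular_mod 11 m; have := ltn_pmod m (isT : 0 < 11)%N.
rewrite !inE.
case Em: (m %% 11)%N => [|[|[|[|[|[|[|[|[|[|[|//]]]]]]]]]]]; lia.
Qed.

Section Convolution11.
Variable S : comNzRingType.

(* Multiplication in the group ring S[Z/11], with elements given on 0, ..., 10. *)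
Definition conv11 (A B : nat -> S) r : S :=
  \sum_(s <- iota 0 11) A s * B ((r + (11 - s)) %% 11)%N.

Lemma eq_conv11 A A' B B' r :
  (forall s, (s < 11)%N -> A s = A' s) -> (forall s, (s < 11)%N -> B s = B' s) ->
  conv11 A B r = conv11 A' B' r.
Proof.
move=> eqA eqB; rewrite /conv11 !big_seq; apply: eq_bigr => s.
by rewrite mem_iota => lt_s; rewrite eqA ?eqB ?ltn_pmod.
Qed.

Ltac expand_conv11 :=
  rewrite /conv11 /= !big_cons big_nil;
  repeat match goal with |- context [modn ?n 11] =>
    let k := eval vm_compute in (modn n 11) in change (modn n 11) with k
  end.

(* The graded membership certificate: the coefficients of A4 2, A4 5, A4 7, A4 8, A4 9 and
   the polynomial U were found by linear algebra over F_11. *)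
Lemma hirschhorn_identity (A : nat -> S) (A2 := conv11 A A) (A3 := conv11 A A2)
    (A4 := conv11 A2 A2) :
  11%:R = 0 :> S ->
  (forall r, r \notin [:: 0; 3; 9; 7; 8]%N -> A r = 0) ->
  (forall r, r \in [:: 2; 5; 7; 8; 9]%N -> A4 r = 0) ->
  conv11 A4 A3 7 = 0.
Proof.
move=> eq11 A0 A40.
have [z1 z2 z4] : [/\ A 1%N = 0, A 2%N = 0 & A 4%N = 0] by split; apply: A0.
have [z5 z6 z10] : [/\ A 5%N = 0, A 6%N = 0 & A 10%N = 0] by split; apply: A0.
pose z := (z1, z2, z4, z5, z6, z10).
set a := A 0%N; set b := A 3%N; set c := A 9%N; set d := A 7%N; set e := A 8%N.
have Q0 : A2 0%N = a ^+ 2 + 2 * b * e.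
  by rewrite /A2; expand_conv11; rewrite !z -/a -/b -/c -/d -/e; ring.
have Q1 : A2 1%N = 2 * b * c.
  by rewrite /A2; expand_conv11; rewrite !z -/a -/b -/c -/d -/e; ring.
have Q2 : A2 2%N = 0.
  by rewrite /A2; expand_conv11; rewrite !z -/a -/b -/c -/d -/e; ring.
have Q3 : A2 3%N = 2 * a * b + d ^+ 2.
  by rewrite /A2; expand_conv11; rewrite !z -/a -/b -/c -/d -/e; ring.
have Q4 : A2 4%N = 2 * d * e.
  by rewrite /A2; expand_conv11; rewrite !z -/a -/b -/c -/d -/e; ring.
have Q5 : A2 5%N = 2 * c * d + e ^+ 2.
  by rewrite /A2; expand_conv11; rewrite !z -/a -/b -/c -/d -/e; ring.
have Q6 : A2 6%N = b ^+ 2 + 2 * c * e.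
  by rewrite /A2; expand_conv11; rewrite !z -/a -/b -/c -/d -/e; ring.
have Q7 : A2 7%N = 2 * a * d + c ^+ 2.
  by rewrite /A2; expand_conv11; rewrite !z -/a -/b -/c -/d -/e; ring.
have Q8 : A2 8%N = 2 * a * e.
  by rewrite /A2; expand_conv11; rewrite !z -/a -/b -/c -/d -/e; ring.
have Q9 : A2 9%N = 2 * a * c.
  by rewrite /A2; expand_conv11; rewrite !z -/a -/b -/c -/d -/e; ring.
have Q10 : A2 10%N = 2 * b * d.
  by rewrite /A2; expand_conv11; rewrite !z -/a -/b -/c -/d -/e; ring.
pose Q := (Q0, Q1, Q2, Q3, Q4, Q5, Q6, Q7, Q8, Q9, Q10).
have K0 : A3 0%N = a ^+ 3 + 6 * a * b * e + 3 * d ^+ 2 * e.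
  by rewrite /A3; expand_conv11; rewrite !z !Q -/a -/b -/c -/d -/e; ring.
have K1 : A3 1%N = 6 * a * b * c + 3 * c * d ^+ 2 + 3 * d * e ^+ 2.
  by rewrite /A3; expand_conv11; rewrite !z !Q -/a -/b -/c -/d -/e; ring.
have K2 : A3 2%N = 3 * b ^+ 2 * d + 6 * c * d * e + e ^+ 3.
  by rewrite /A3; expand_conv11; rewrite !z !Q -/a -/b -/c -/d -/e; ring.
have K3 : A3 3%N = 3 * a ^+ 2 * b + 3 * a * d ^+ 2 + 3 * b ^+ 2 * e + 3 * c ^+ 2 * d
    + 3 * c * e ^+ 2.
  by rewrite /A3; expand_conv11; rewrite !z !Q -/a -/b -/c -/d -/e; ring.
have K4 : A3 4%N = 6 * a * d * e + 3 * b ^+ 2 * c + 3 * c ^+ 2 * e.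
  by rewrite /A3; expand_conv11; rewrite !z !Q -/a -/b -/c -/d -/e; ring.
have K5 : A3 5%N = 6 * a * c * d + 3 * a * e ^+ 2 + c ^+ 3.
  by rewrite /A3; expand_conv11; rewrite !z !Q -/a -/b -/c -/d -/e; ring.
have K6 : A3 6%N = 3 * a * b ^+ 2 + 6 * a * c * e + 3 * b * d ^+ 2.
  by rewrite /A3; expand_conv11; rewrite !z !Q -/a -/b -/c -/d -/e; ring.
have K7 : A3 7%N = 3 * a ^+ 2 * d + 3 * a * c ^+ 2 + 6 * b * d * e.
  by rewrite /A3; expand_conv11; rewrite !z !Q -/a -/b -/c -/d -/e; ring.
have K8 : A3 8%N = 3 * a ^+ 2 * e + 6 * b * c * d + 3 * b * e ^+ 2.
  by rewrite /A3; expand_conv11; rewrite !z !Q -/a -/b -/c -/d -/e; ring.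
have K9 : A3 9%N = 3 * a ^+ 2 * c + b ^+ 3 + 6 * b * c * e.
  by rewrite /A3; expand_conv11; rewrite !z !Q -/a -/b -/c -/d -/e; ring.
have K10 : A3 10%N = 6 * a * b * d + 3 * b * c ^+ 2 + d ^+ 3.
  by rewrite /A3; expand_conv11; rewrite !z !Q -/a -/b -/c -/d -/e; ring.
pose K := (K0, K1, K2, K3, K4, K5, K6, K7, K8, K9, K10).
have R0 : A4 0%N = a ^+ 4 + 12 * a ^+ 2 * b * e + 12 * a * d ^+ 2 * e
    + 12 * b ^+ 2 * c * d + 6 * b ^+ 2 * e ^+ 2 + 12 * c ^+ 2 * d * e
    + 4 * c * e ^+ 3.
  by rewrite /A4; expand_conv11; rewrite !Q; ring.
have R1 : A4 1%N = 12 * a ^+ 2 * b * c + 12 * a * c * d ^+ 2 + 12 * a * d * e ^+ 2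
    + b ^+ 4 + 12 * b ^+ 2 * c * e + 4 * c ^+ 3 * d + 6 * c ^+ 2 * e ^+ 2.
  by rewrite /A4; expand_conv11; rewrite !Q; ring.
have R2 : A4 2%N = 12 * a * b ^+ 2 * d + 24 * a * c * d * e + 4 * a * e ^+ 3
    + 6 * b ^+ 2 * c ^+ 2 + 4 * b * d ^+ 3 + 4 * c ^+ 3 * e.
  by rewrite /A4; expand_conv11; rewrite !Q; ring.
have R3 : A4 3%N = 4 * a ^+ 3 * b + 6 * a ^+ 2 * d ^+ 2 + 12 * a * b ^+ 2 * e
    + 12 * a * c ^+ 2 * d + 12 * a * c * e ^+ 2 + 12 * b * d ^+ 2 * e + c ^+ 4.
  by rewrite /A4; expand_conv11; rewrite !Q; ring.
have R4 : A4 4%N = 12 * a ^+ 2 * d * e + 12 * a * b ^+ 2 * c + 12 * a * c ^+ 2 * e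
    + 12 * b * c * d ^+ 2 + 12 * b * d * e ^+ 2.
  by rewrite /A4; expand_conv11; rewrite !Q; ring.
have R5 : A4 5%N = 12 * a ^+ 2 * c * d + 6 * a ^+ 2 * e ^+ 2 + 4 * a * c ^+ 3
    + 4 * b ^+ 3 * d + 24 * b * c * d * e + 4 * b * e ^+ 3.
  by rewrite /A4; expand_conv11; rewrite !Q; ring.
have R6 : A4 6%N = 6 * a ^+ 2 * b ^+ 2 + 12 * a ^+ 2 * c * e + 12 * a * b * d ^+ 2
    + 4 * b ^+ 3 * e + 12 * b * c ^+ 2 * d + 12 * b * c * e ^+ 2 + d ^+ 4.
  by rewrite /A4; expand_conv11; rewrite !Q; ring.
have R7 : A4 7%N = 4 * a ^+ 3 * d + 6 * a ^+ 2 * c ^+ 2 + 24 * a * b * d * e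
    + 4 * b ^+ 3 * c + 12 * b * c ^+ 2 * e + 4 * d ^+ 3 * e.
  by rewrite /A4; expand_conv11; rewrite !Q; ring.
have R8 : A4 8%N = 4 * a ^+ 3 * e + 24 * a * b * c * d + 12 * a * b * e ^+ 2
    + 4 * b * c ^+ 3 + 4 * c * d ^+ 3 + 6 * d ^+ 2 * e ^+ 2.
  by rewrite /A4; expand_conv11; rewrite !Q; ring.
have R9 : A4 9%N = 4 * a ^+ 3 * c + 4 * a * b ^+ 3 + 24 * a * b * c * e
    + 6 * b ^+ 2 * d ^+ 2 + 12 * c * d ^+ 2 * e + 4 * d * e ^+ 3.
  by rewrite /A4; expand_conv11; rewrite !Q; ring.
have R10 : A4 10%N = 12 * a ^+ 2 * b * d + 12 * a * b * c ^+ 2 + 4 * a * d ^+ 3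
    + 12 * b ^+ 2 * d * e + 6 * c ^+ 2 * d ^+ 2 + 12 * c * d * e ^+ 2 + e ^+ 4.
  by rewrite /A4; expand_conv11; rewrite !Q; ring.
pose R := (R0, R1, R2, R3, R4, R5, R6, R7, R8, R9, R10).
pose U := a ^+ 6 * d + a ^+ 5 * c ^+ 2 + 22 * a ^+ 4 * b * d * e
    + 12 * a ^+ 3 * b ^+ 3 * c + 30 * a ^+ 3 * b * c ^+ 2 * e
    + 12 * a ^+ 3 * d ^+ 3 * e + 54 * a ^+ 2 * b ^+ 2 * c * d ^+ 2
    + 54 * a ^+ 2 * b ^+ 2 * d * e ^+ 2 + 54 * a ^+ 2 * c ^+ 2 * d ^+ 2 * e
    + 30 * a ^+ 2 * c * d * e ^+ 3 + a ^+ 2 * e ^+ 5 + a * b ^+ 6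
    + 22 * a * b ^+ 4 * c * e + 30 * a * b ^+ 2 * c ^+ 3 * d
    + 54 * a * b ^+ 2 * c ^+ 2 * e ^+ 2 + 22 * a * b * c * d ^+ 4
    + 30 * a * b * d ^+ 3 * e ^+ 2 + 22 * a * c ^+ 4 * d * e
    + 12 * a * c ^+ 3 * e ^+ 3 + b ^+ 5 * d ^+ 2 + 30 * b ^+ 3 * c * d ^+ 2 * e
    + 12 * b ^+ 3 * d * e ^+ 3 + b ^+ 2 * c ^+ 5 + 12 * b * c ^+ 3 * d ^+ 3
    + 54 * b * c ^+ 2 * d ^+ 2 * e ^+ 2 + 22 * b * c * d * e ^+ 4 + b * e ^+ 6
    + c ^+ 6 * e + c * d ^+ 6 + d ^+ 5 * e ^+ 2.
(* This identity holds over the integers, hence [ring]. The cofactor of [A4 r] is a cubic form of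
   class [7 - r] mod 11, and [11 * U] collects what is left. *)
transitivity (11%:R * U + (4 * a * e ^+ 2 - c ^+ 3 - a * c * d) * A4 2%N
    + (4 * b ^+ 2 * d - e ^+ 3 - c * d * e) * A4 5%N
    + (4 * d ^+ 2 * e - a * b * e - a ^+ 3) * A4 7%N
    + (4 * b * c ^+ 2 - d ^+ 3 - a * b * d) * A4 8%N
    + (4 * a ^+ 2 * c - b * c * e - b ^+ 3) * A4 9%N).
  by expand_conv11; rewrite !R !K /U; ring.
by rewrite !A40 // eq11 mul0r !mulr0 !addr0.
Qed.

End Convolution11.

Lemma class_part11M (R : comNzRingType) (f g : fps R) r : (r < 11)%N ->
  class_part 11 (f * g) r = conv11 (class_part 11 f) (class_part 11 g) r.
Proof.
move=> lt_r; rewrite class_partM // /conv11.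
by rewrite -(big_mkord xpredT
  (fun s => class_part 11 f s * class_part 11 g ((r + (11 - s)) %% 11)%N)).
Qed.

Lemma euler3_exp21_vanish m : (m %% 11)%N = 7 -> (euler 'F_11 3 ^+ 21) m = 0.
Proof.
move=> m7; have F11 := pchar_Fp (isT : prime 11).
pose f := euler 'F_11 3 ^+ 3.
have f_comp0 r : r \notin [:: 0; 3; 9; 7; 8]%N -> class_part 11 f r = 0.
  move=> r'; apply: fpsP => n; rewrite coef_class_part; case: eqP => // nr.
  have [-> // | /(euler3_cubed_supp F11)[b nb p'b]] := eqVneq (f n) 0.
  by move: r'; rewrite -nr nb triple_triangular11_mod.
(* Here [f^4 = E^12 = E^11 * E] and [E^11] is a series in [q^11], so only the classes of triangular
   numbers occur. The five missing ones are 2, 5, 7, 8 and 9. *)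
have f4_comp0 r : r \notin [:: 0; 1; 3; 6; 10; 4]%N -> class_part 11 (f ^+ 4) r = 0.
  move=> r'; apply: fpsP => n; rewrite coef_class_part; case: eqP => // nr.
  rewrite -exprM (exprD _ 11 1); apply: supp_mul_vanish nr => [i|i ir].
    exact: fps_exp_pchar_supp.
  rewrite expr1; have [-> // | /euler3_supp[b ib]] := eqVneq (euler 'F_11 3 i) 0.
  by move: r'; rewrite -ir ib triangular11_mod.
suff f7 : class_part 11 (f ^+ 7) 7 = 0.
  have : class_part 11 (f ^+ 7) 7 m = 0 by rewrite f7.
  by rewrite coef_class_part m7 eqxx -exprM.
pose A := class_part 11 f; have f2E r : (r < 11)%N -> class_part 11 (f ^+ 2) r = conv11 A A r.
  by move=> lt_r; rewrite expr2 class_part11M.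
have f4E r : (r < 11)%N -> class_part 11 (f ^+ 4) r =
    conv11 (conv11 A A) (conv11 A A) r.
  by move=> lt_r; rewrite (exprD f 2 2) class_part11M //; apply: eq_conv11.
rewrite (exprD f 4 3) class_part11M //.
rewrite (eq_conv11 (B' := conv11 A (conv11 A A)) _ f4E).
  apply: hirschhorn_identity => // [|r r_in]; first exact: pcharf0 (fps_pchar F11).
  rewrite -f4E; last by move: r r_in; apply/allP.
  by apply: f4_comp0; move: r r_in; apply/allP.
by move=> r lt_r; rewrite exprS class_part11M //; apply: eq_conv11.
Qed.

Theorem theorem3p3 (J N : nat) :
  (MO 1 (5 * J + 4) (5 * N + 2) = 0 %[mod 5])%Z /\
  (MO 1 (7 * J + 6) (7 * N + 1) = 0 %[mod 7])%Z /\
  (MO 1 (11 * J + 10) (11 * N + 7) = 0 %[mod 11])%Z.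
Proof.
split; [|split].
- by apply: (@MO_eq0_mod 5 1 2) => //; [exact: euler3_exp4_vanish | lia | lia].
- by apply: (@MO_eq0_mod 7 1 1) => //; [exact: euler3_exp6_vanish | lia | lia].
(* Taking [k = 2] gives the exponent 21, a multiple of 3, so that the power of [E] is a power of
   [E^3]; [k = 1] would give 10. *)
- by apply: (@MO_eq0_mod 11 2 7) => //; [exact: euler3_exp21_vanish | lia | lia].
Qed.
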